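(* For convex sets $C,D\subseteq\mathbb{R}^n$, $$T_a(C,D)=\operatorname{aff}\big(F_C(C\cap D)\cup F_D(C\cap D)\big),$$ where $T_a(C,D)$ is the affine joint supporting subspace of $C$ and $D$.
   Context: $\operatorname{aff}$ denotes the affine hull, with $\operatorname{aff}(\emptyset)=\emptyset$. $A\pm B=\{a\pm b\mid a\in A,b\in B\}$. Faces: for $C\subseteq\mathbb{R}^n$ convex, a subset $F\subseteq C$ is a face of $C$ if for all $y,z\in C$, whenever the open segment $]y,z[ = [y,z]\setminus\{y,z\}$ meets $F$, both $y,z\in F$ (so $\emptyset$ is a face). For $S\subseteq C$, $F_C(S)$ denotes the smallest face of $C$ containing $S$ (so $F_C(\emptyset)=\emptyset$); $F_C(x)=F_C(\{x\})$. Joint supporting subspace: for convex $C,D\subseteq\mathbb{R}^n$ with $C\cap D\neq\emptyset$, $T(C,D):=\operatorname{Span} F_{C-D}(0)$ (linear span) and $T_a(C,D):=T(C,D)+(C\cap D)$. If $C\cap D=\emptyset$, then $T_a(C,D)=\emptyset$. *)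

(* Defs.v *)
From mathcomp Require Import all_boot all_order all_algebra.
From mathcomp Require Import interval_inference boolp classical_sets reals convex.

Set Implicit Arguments.
Unset Strict Implicit.
Unset Printing Implicit Defensive.

Import Order.TTheory GRing.Theory Num.Theory.
Local Open Scope classical_set_scope.
Local Open Scope ring_scope.

Section Defs.
Context {R : realType} {V : lmodType R}.
Implicit Types (A C D F S : set V) (x y z : V).

Definition segment y z : set V :=
  range (fun t : {i01 R} => conv t (y : convex_lmodType V) z).

(* In particular open_segment y y is empty. *)
Definition open_segment y z : set V := segment y z `\` [set y; z].

(* Faces are not required to be convex, and set0 is a face. *)
Definition is_face C F : Prop :=
  F `<=` C /\
  forall y z, C y -> C z -> open_segment y z `&` F !=set0 -> F y /\ F z.

(* The smallest face of C containing S; meaningful when S `<=` C, as otherwise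
   no face of C contains S and the intersection of the empty family is setT. *)
Definition face_hull C S : set V := smallest (is_face C) S.

Lemma face_hullP C S : S `<=` C -> is_face C (face_hull C S).
Proof.
move=> SC; split=> [|y z Cy Cz [w [yzw Fw]]].
  by apply: smallest_sub => //; split=> // y z.
have Fyz F : is_face C F /\ S `<=` F -> F y /\ F z.
  by move=> FS; apply: FS.1.2 => //; exists w; split=> //; exact: Fw.
by split=> F FS; case: (Fyz F FS).
Qed.

Definition is_affine A : Prop :=
  forall (t : R) x y, A x -> A y -> A ((1 - t) *: x + t *: y).

Definition affine_hull S : set V := smallest is_affine S.

Definition linear_span S : set V :=
  smallest (fun U : set V => submod_closed (mem U)) S.

Definition minkowski_add A B : set V := [set a + b | a in A & b in B].
Definition minkowski_sub A B : set V := [set a - b | a in A & b in B].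

(* Meaningful only when C `&` D !=set0, that is, when minkowski_sub C D 0. *)
Definition joint_supp C D : set V :=
  linear_span (face_hull (minkowski_sub C D) [set 0]).

Definition affine_joint_supp C D : set V :=
  minkowski_add (joint_supp C D) (C `&` D).

(* The convention for disjoint C and D needs no case distinction. *)
Lemma affine_joint_supp0 C D : C `&` D = set0 -> affine_joint_supp C D = set0.
Proof.
by move=> CD; apply/seteqP; split=> // x [t _ [y]]; rewrite CD.
Qed.

End Defs.

(* Main.v *)
Require Import Defs.
From mathcomp Require Import all_boot all_order all_algebra.
From mathcomp Require Import interval_inference boolp classical_sets reals convex.
From mathcomp Require Import lra.

(** The proof rests on a description of the smallest face by convex combinations
    ([face_hullE]): a point [y] of a convex set [C] lies in the smallest face
    containing [S] exactly when some point of [S] is a proper convex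
    combination [a *: y + (1 - a) *: v] of [y] and a point [v] of [C].

    Applied to [C - D] and the origin, this says that [c - d] lies in the face
    [F] of [0] iff [a *: (c - d) + (1 - a) *: (c' - d') = 0] for some [c'] in
    [C], [d'] in [D] and [0 < a < 1].  This equation may be read as
    [a *: c + (1 - a) *: c' = a *: d + (1 - a) *: d'], and the common value is
    a point of [C] and of [D].  So [c] and [d] belong to the faces of [C] and
    of [D] generated by the intersection, and [c - d] is a direction of the
    affine hull of these faces ([face_hull_sub0]).

    Conversely, if [y] is in the face of [C] generated by [C `&` D], a point
    [x = a *: y + (1 - a) *: v] of the intersection gives
    [a *: (y - x) + (1 - a) *: (v - x) = 0], so that [y - x] is in [F] and
    [y = (y - x) + x] is in the affine joint supporting subspace; the argument
    for [D] is the same up to sign ([sub_face_hull_l], [sub_face_hull_r]).  It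
    remains that this subspace is affine ([is_affine_joint_supp]), because the
    differences of points of [C `&` D] lie in [F].  If [C] and [D] are disjoint
    these arguments show that both sides are empty. *)

Set Implicit Arguments.
Unset Strict Implicit.
Unset Printing Implicit Defensive.

Import Order.TTheory GRing.Theory Num.Theory.
Local Open Scope classical_set_scope.
Local Open Scope ring_scope.

(** * Convex sets and segments *)

Section JointSupport.
Context {R : realType} {V : lmodType R}.
Implicit Types (A C D F S : set V) (x y z v w : V) (a b t : R).

Lemma scaleDK a x : a *: x + (1 - a) *: x = x.
Proof. by rewrite -scalerDl addrC subrK scale1r. Qed.

Lemma i01_num a : 0 <= a <= 1 -> exists t : {i01 R}, t%:num = a.
Proof.
move=> a01.
have a_i01 : Itv.spec (@Itv.num_sem R)
    (Itv.Real (Interval (BSide true 0%Z) (BSide false 1%Z))) a.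
  by rewrite /= /Itv.num_sem /= in_itv /= num_real.
by exists (Itv.Def a_i01).
Qed.

Lemma convex_setD C a b x y : convex_set C ->
  0 <= a -> 0 <= b -> a + b = 1 -> C x -> C y -> C (a *: x + b *: y).
Proof.
move=> cC a0 b0 ab /mem_set Cx /mem_set Cy.
have [|t ta] := i01_num (a := a); first by lra.
have -> : b = 1 - a by lra.
by have /set_mem := cC x y t Cx Cy; rewrite /conv /= /unstable.onem ta.
Qed.

Lemma open_segmentE y z w : open_segment y z w ->
  exists a b, [/\ 0 < a, 0 < b, a + b = 1 & w = a *: y + b *: z].
Proof.
move=> [[t _ <-] nyz]; exists t%:num, (1 - t%:num).
have t0 : t%:num != 0.
  apply: contra_notN nyz => /eqP t0; right.
  by rewrite /conv /= /unstable.onem t0 scale0r add0r subr0 scale1r.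
have t1 : t%:num != 1.
  apply: contra_notN nyz => /eqP t1; left.
  by rewrite /conv /= /unstable.onem t1 subrr scale0r addr0 scale1r.
split=> //; last by lra.
  by rewrite lt_neqAle eq_sym t0 ge0.
by rewrite subr_gt0 lt_neqAle t1 le1.
Qed.

Lemma mem_open_segment y z a : y != z -> 0 < a < 1 ->
  open_segment y z (a *: y + (1 - a) *: z).
Proof.
move=> yz a01.
have [|t ta] := i01_num (a := a); first by lra.
split; first by exists t => //; rewrite /conv /= /unstable.onem ta.
move=> [] /eqP.
- rewrite -subr_eq0 -[in X in _ - X](scaleDK a y) addrAC opprD addrA subrr.
  rewrite add0r addrC -scalerBr scaler_eq0 !subr_eq0 eq_sym [z == y]eq_sym.
  by rewrite (negPf yz) orbF => /eqP; lra.
- rewrite -subr_eq0 -[in X in _ - X](scaleDK a z) opprD addrACA subrr addr0.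
  rewrite -scalerBr scaler_eq0 subr_eq0 (negPf yz) orbF => /eqP; lra.
Qed.

(** * The smallest face as a set of convex combinations *)

Definition face_points C S : set V := [set y | C y /\
  exists x v a, [/\ S x, C v, 0 < a < 1 & x = a *: y + (1 - a) *: v]].

Lemma face_points_endpoint C S y z a b : convex_set C ->
  C y -> C z -> 0 < a -> 0 < b -> a + b = 1 ->
  face_points C S (a *: y + b *: z) -> face_points C S y.
Proof.
move=> cC Cy Cz a0 b0 ab [_ [x [v [s [Sx Cv s01 xE]]]]]; split=> //.
have sa0 : 0 < s * a by rewrite mulr_gt0//; lra.
have sb0 : 0 < s * b by rewrite mulr_gt0//; lra.
have sab : s * a + s * b = s by rewrite -mulrDr ab mulr1.
have c0 : 0 < 1 - s * a by lra.
(* x = (s a) y + (s b) z + (1 - s) v: the last two terms are merged. *)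
exists x, ((1 - s * a)^-1 * (s * b) *: z + (1 - s * a)^-1 * (1 - s) *: v).
exists (s * a); split=> //; last 2 first.
- by lra.
- rewrite xE [in RHS]scalerDr !scalerA !mulrA divff ?gt_eqF// !mul1r.
  by rewrite scalerDr !scalerA addrA.
apply: convex_setD => //.
- by rewrite mulr_ge0 ?invr_ge0 ?ltW.
- by rewrite mulr_ge0 ?invr_ge0; lra.
- rewrite -mulrDr (_ : s * b + (1 - s) = 1 - s * a); last by lra.
  by rewrite mulVf ?gt_eqF.
Qed.

(** [face_points C S] is a face because a convex combination of convex
    combinations is one, and it is the least because its points are endpoints
    of open segments of [C] that meet [S]. *)
Lemma face_hullE C S : convex_set C -> S `<=` C ->
  face_hull C S = face_points C S.
Proof.
move=> cC SC; apply/seteqP; split.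
- apply: smallest_sub; last first.
    move=> x Sx; split; first exact: SC.
    exists x, x, 2^-1; split=> //; [exact: SC|lra|].
    by rewrite scaleDK.
  split=> [y []//|y z Cy Cz [_ [/open_segmentE[a [b [a0 b0 ab ->]]] Fw]]].
  split; first exact: face_points_endpoint Fw.
  apply: (@face_points_endpoint C S z y b a) => //; first by rewrite addrC.
  by rewrite [_ + _]addrC.
- move=> y [Cy [x [v [a [Sx Cv a01 xE]]]]] F [[_ Fface] SF].
  have [yv|yv] := eqVneq y v.
    by apply: SF; move: Sx; rewrite xE -yv scaleDK.
  suff /(Fface y v Cy Cv)[] : open_segment y v `&` F !=set0 by [].
  by exists x; split; [rewrite xE; exact: mem_open_segment|exact: SF].
Qed.

Lemma convex_minkowski_sub C D : convex_set C -> convex_set D ->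
  convex_set (minkowski_sub C D).
Proof.
move=> cC cD x y t /set_mem[c Cc [d Dd <-]] /set_mem[c' Cc' [d' Dd' <-]].
apply/mem_set; exists (conv t (c : convex_lmodType V) c').
  by apply/set_mem/cC; exact/mem_set.
exists (conv t (d : convex_lmodType V) d').
  by apply/set_mem/cD; exact/mem_set.
by rewrite /conv /= opprD addrACA -!scalerBr.
Qed.

(** * Affine hulls and linear spans *)

Lemma is_affine_hull S : is_affine (affine_hull S).
Proof. by move=> t x y Ax Ay A AS; apply: AS.1; [exact: Ax|exact: Ay]. Qed.

Lemma linear_span0 S : linear_span S 0.
Proof. by move=> U [[U0 _] _]; exact/set_mem. Qed.

Lemma linear_spanP S a x y :
  linear_span S x -> linear_span S y -> linear_span S (a *: x + y).
Proof.
move=> Sx Sy U US; apply/set_mem; apply: US.1.2; apply/mem_set.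
  exact: Sx.
exact: Sy.
Qed.

Lemma is_affine_sub A x c d : is_affine A -> A x -> A c -> A d ->
  A (c - d + x).
Proof.
move=> affA Ax Ac Ad.
(* c - d + x is the reflection of d in the midpoint of c and x. *)
have := affA 2 _ _ Ad (affA 2^-1 _ _ Ac Ax); congr A.
rewrite scalerDr !scalerA divff// scale1r (_ : 2 * (1 - 2^-1) = 1); last by lra.
by rewrite scale1r (_ : 1 - 2 = -1); [rewrite scaleN1r addrA [- d + c]addrC|lra].
Qed.

(** The vectors along which a given affine set is invariant form a linear
    subspace, so it is enough to check the generators. *)
Lemma linear_span_translate A S : is_affine A ->
  (forall w x, S w -> A x -> A (w + x)) ->
  forall w x, linear_span S w -> A x -> A (w + x).
Proof.
move=> affA SA w x Sw; move: x.
apply: (smallest_sub (X := [set u | forall x, A x -> A (u + x)])) Sw.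
  split; first by apply/mem_set => x; rewrite add0r.
  move=> a u v /set_mem uA /set_mem vA; apply/mem_set => x Ax.
  rewrite -addrA; have Avx := vA x Ax.
  have := affA a _ _ Avx (uA _ Avx); congr A.
  by rewrite [a *: (_ + _)]scalerDr [LHS]addrCA [X in _ + X = _]addrC scaleDK.
by move=> u Su y Ay; exact: SA.
Qed.

(** * The joint supporting subspace *)

Section TwoConvexSets.
Variables C D : set V.
Hypotheses (cC : convex_set C) (cD : convex_set D).

Lemma sub_minkowski_sub0 x : C x -> D x -> [set 0] `<=` minkowski_sub C D.
Proof. by move=> Cx Dx _ ->; exists x => //; exists x; rewrite ?subrr. Qed.

(** A negative multiple of [w] in [C - D] keeps the origin inside a segment
    issued from [w]. *)
Lemma joint_supp_mem x w v a : C x -> D x ->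
  minkowski_sub C D w -> minkowski_sub C D v -> 0 < a < 1 ->
  a *: w + (1 - a) *: v = 0 -> joint_supp C D w.
Proof.
move=> Cx Dx CDw CDv a01 wv0; apply: sub_gen_smallest.
rewrite face_hullE; [|exact: convex_minkowski_sub|exact: sub_minkowski_sub0 Dx].
by split=> //; exists 0, v, a.
Qed.

Lemma sub_face_hull_l : face_hull C (C `&` D) `<=` affine_joint_supp C D.
Proof.
rewrite face_hullE//= => y [Cy [x [v [a [[Cx Dx] Cv a01 xE]]]]].
exists (y - x); last by exists x => //; rewrite subrK.
apply: (@joint_supp_mem x _ (v - x) a) => //.
- by exists y => //; exists x.
- by exists v => //; exists x.
- by rewrite !scalerBr addrACA -opprD scaleDK -xE subrr.
Qed.

Lemma sub_face_hull_r : face_hull D (C `&` D) `<=` affine_joint_supp C D.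
Proof.
rewrite face_hullE//= => y [Dy [x [v [a [[Cx Dx] Dv a01 xE]]]]].
have Txy : joint_supp C D (x - y).
  apply: (@joint_supp_mem x _ (x - v) a) => //.
  - by exists x => //; exists y.
  - by exists x => //; exists v.
  - by rewrite !scalerBr addrACA -opprD scaleDK -xE subrr.
exists (y - x); last by exists x => //; rewrite subrK.
rewrite -opprB -scaleN1r -[_ *: _]addr0.
by apply: linear_spanP => //; exact: linear_span0.
Qed.

Lemma is_affine_joint_supp : is_affine (affine_joint_supp C D).
Proof.
move=> t _ _ [u Tu [x [Cx Dx] <-]] [u' Tu' [x' [Cx' Dx'] <-]].
(* The origin is the midpoint of x' - x and x - x'. *)
have Txx : joint_supp C D (x' - x).
  apply: (@joint_supp_mem x _ (x - x') 2^-1) => //.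
  - by exists x' => //; exists x.
  - by exists x => //; exists x'.
  - by lra.
  - by rewrite -[x - x']opprB scalerN -scalerBl (_ : 2^-1 - _ = 0) ?scale0r//; lra.
exists ((1 - t) *: u + (t *: u' + (t *: (x' - x) + 0))).
  by do 3! apply: linear_spanP => //; exact: linear_span0.
exists x => //; rewrite addr0 -!addrA.
have -> : t *: (x' - x) + x = (1 - t) *: x + t *: x'.
  by rewrite scalerBr scalerBl scale1r addrC [RHS]addrAC addrA.
by rewrite !scalerDr [RHS]addrACA addrA.
Qed.

(** The points [c] and [d] of a vector [c - d] of the face of [0] are found in
    the faces generated by [C `&` D]: a segment of [C] starting from [c] and a
    segment of [D] starting from [d] cross. *)
Lemma face_hull_sub0 x w : C x -> D x ->
  face_hull (minkowski_sub C D) [set 0] w ->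
  exists c d, [/\ face_hull C (C `&` D) c, face_hull D (C `&` D) d & w = c - d].
Proof.
move=> Cx Dx.
rewrite face_hullE; [|exact: convex_minkowski_sub|exact: sub_minkowski_sub0 Dx].
move=> [[c Cc [d Dd <-]] [_ [_ [a [-> [c' Cc' [d' Dd' <-]] a01 cd0]]]]].
have pE : a *: c + (1 - a) *: c' = a *: d + (1 - a) *: d'.
  by apply/eqP; rewrite -subr_eq0 opprD addrACA -!scalerBr -cd0.
have CDp : (C `&` D) (a *: c + (1 - a) *: c').
  by split; [|rewrite pE]; apply: convex_setD => //; lra.
exists c, d; split=> //.
- by rewrite face_hullE//; split=> //; exists (a *: c + (1 - a) *: c'), c', a.
- by rewrite face_hullE//; split=> //; exists (a *: c + (1 - a) *: c'), d', a.
Qed.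

Lemma affine_joint_suppE : affine_joint_supp C D =
  affine_hull (face_hull C (C `&` D) `|` face_hull D (C `&` D)).
Proof.
apply/seteqP; split; last first.
  apply: smallest_sub; first exact: is_affine_joint_supp.
  by move=> y [/sub_face_hull_l|/sub_face_hull_r].
move=> _ [u Tu [x [Cx Dx] <-]]; set H := affine_hull _.
have affH : is_affine H by exact: is_affine_hull.
apply: (linear_span_translate affH _ Tu).
  move=> w y /(face_hull_sub0 Cx Dx)[c [d [Fc Fd ->]]] Hy.
  by apply: (is_affine_sub affH) => //; apply: sub_gen_smallest; [left|right].
by apply: sub_gen_smallest; left; apply: sub_gen_smallest.
Qed.

End TwoConvexSets.
End JointSupport.

Unset Implicit Arguments.

Theorem corollary4p2 (R : realType) (n : nat) (C D : set 'rV[R]_n)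
    (convC : convex_set C) (convD : convex_set D) :
  affine_joint_supp C D =
  affine_hull (face_hull C (C `&` D) `|` face_hull D (C `&` D)).
Proof. exact: affine_joint_suppE. Qed.
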